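(* Let $(G,M,\Delta)$ be a Garside group and assume that $M$ is the associated monoid $M^+_{\mathcal{P}}$ of some finite positive presentation $\mathcal{P}=\langle \mathcal{S} \mid \mathcal{R}\rangle$ of $G$ such that (i) all relations in $\mathcal{R}$ are Hurwitz-compatible, and (ii) the generating set $\mathcal{S}$ is equal to the set of atoms of $M$. Then for generator $G$-systems $\mathbf{a}$ and $\mathbf{a}'$: (1) $\mathbf{a} \sim_{H} \mathbf{a}'$ if and only if $C(\mathbf{a}) = C(\mathbf{a}')$. (2) If $\Delta^{-1}C(\mathbf{a}) \in M_{\mathcal{P}}^{+}$, then $\mathbf{a} \sim_{HC} \mathbf{a}'$ if and only if $C(\mathbf{a})$ and $C(\mathbf{a}')$ are conjugate in $G$.
   Context: Garside groups (standard definition). An atom of a monoid $M$ with no nontrivial invertible elements is an element $a\neq 1$ such that $a=bc$ with $b,c\in M$ implies $b=1$ or $c=1$. A Garside group is a triple $(G,M,\Delta)$ where: $M$ is a cancellative monoid generated by its set of atoms, which is finite, and for each $x\in M$ the lengths of expressions of $x$ as a product of atoms are bounded (in particular $1$ is the only invertible element); any two elements of $M$ have a greatest common divisor and a least common multiple with respect to left divisibility, and likewise with respect to right divisibility; $\Delta\in M$ is an element whose left divisors and right divisors coincide, form a finite set, and generate $M$; and $G$ is the group of fractions of $M$. In particular $M$ embeds in $G$ and is regarded as a submonoid of $G$, and $\Delta$ is a common left and right multiple of all atoms. Positive presentations. For a set $\mathcal{S}$, $\mathcal{S}^*$ is the free monoid on $\mathcal{S}$. A positive relation is a pair of words $V,W\in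 \mathcal{S}^*$, written $V\equiv W$. A positive presentation of $G$ is a group presentation $\langle\mathcal{S}\mid\mathcal{R}\rangle$ with $\mathcal{R}$ a set of positive relations, $V\equiv W$ being read as $V^{-1}W=1$; it is finite if $\mathcal{S},\mathcal{R}$ are finite. The associated monoid is $M^+_{\mathcal{P}}=\mathcal{S}^*/\!\equiv$, where $\equiv$ is the smallest congruence containing $\mathcal{R}$. Here ''$M$ is the associated monoid'' means that the natural map $M^+_{\mathcal{P}}\to G$ is an isomorphism onto $M$, so $M^+_{\mathcal{P}}$ is identified with $M\subset G$. Hurwitz action. A $G$-system of length $m$ is an element of $G^m$; a generator $G$-system is an element of $\mathcal{S}^m$ for some $m$. The braid group $B_m$, with standard generators $\sigma_1,\dots,\sigma_{m-1}$, acts on $G^m$ from the right by $(g_1,\dots,g_m)\cdot\sigma_i=(g_1,\dots,g_{i-1},g_{i+1},g_{i+1}^{-1}g_ig_{i+1},g_{i+2},\dots,g_m)$. The group $G$ acts on $G^m$ from the right by $(g_1,\dots,g_m)\cdot g=(g^{-1}g_1g,\dots,g^{-1}g_mg)$; the two actions commute, giving an action of $G\times B_m$. Two $G$-systems are Hurwitz equivalent ($\sim_H$) if they have the same length $m$ and are in the same $B_m$-orbit, and Hurwitz-conjugation (HC-) equivalent ($\sim_{HC}$) if they have the same length $m$ and are in the same $(G\times B_m)$-orbit. The Coxeter element of $\mathbf{g}=(g_1,\dots,g_m)$ is $C(\mathbf{g})=g_1g_2\cdots g_m\in G$. Hurwitz-compatibility. A positive relation $V\equiv W$ with $V=a_1\cdots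 a_l$ and $W=a'_1\cdots a'_l$ of equal length ($a_i,a_i'\in\mathcal{S}$) is Hurwitz-compatible if there is a braid $\beta\in B_l$ with $(a_1,\dots,a_l)\cdot\beta=(a'_1,\dots,a'_l)$ in $G^l$. (Hurwitz-compatible relations are by definition between words of the same length.) *)

(* Defs.v *)
From HB Require Import structures.
From mathcomp Require Import all_boot.
From mathcomp Require Import boolp.
From mathcomp Require Import zify.

Set Implicit Arguments.
Unset Strict Implicit.
Unset Printing Implicit Defensive.

Local Open Scope group_scope.
Local Open Scope quotient_scope.

Inductive congr_closure (X : Type) (R : seq X -> seq X -> Prop) :
    seq X -> seq X -> Prop :=
  | congr_rel u v : R u v -> congr_closure R u v
  | congr_refl u : congr_closure R u u
  | congr_sym u v : congr_closure R u v -> congr_closure R v u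
  | congr_trans u v w :
      congr_closure R u v -> congr_closure R v w -> congr_closure R u w
  | congr_cat u u' v v' : congr_closure R u u' -> congr_closure R v v' ->
      congr_closure R (u ++ v) (u' ++ v').

Section PresentedMonoid.
Variables (X : choiceType) (R : seq X -> seq X -> Prop).

Definition congr_bool : rel (seq X) := fun u v => `[< congr_closure R u v >].

Lemma congr_bool_refl : reflexive congr_bool.
Proof. by move=> u; apply/asboolP; exact: congr_refl. Qed.

Lemma congr_bool_sym : symmetric congr_bool.
Proof. by move=> u v; apply/asboolP/asboolP; exact: congr_sym. Qed.

Lemma congr_bool_trans : transitive congr_bool.
Proof.
by move=> v u w /asboolP uv /asboolP vw; apply/asboolP/(congr_trans uv vw).
Qed.

Canonical congr_equiv :=
  EquivRel congr_bool congr_bool_refl congr_bool_sym congr_bool_trans.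

Definition presented_monoid : Type := {eq_quot congr_equiv}.

HB.instance Definition _ := Choice.on presented_monoid.
HB.instance Definition _ := Quotient.on presented_monoid.

Definition word_class (u : seq X) : presented_monoid := \pi_presented_monoid u.
Definition class_word (x : presented_monoid) : seq X := repr x.

Lemma word_classP u v : word_class u = word_class v <-> congr_closure R u v.
Proof.
rewrite /word_class; split=> [/eqP|uv].
  by rewrite (eqmodE congr_equiv) => /asboolP.
by apply/eqP; rewrite (eqmodE congr_equiv); apply/asboolP.
Qed.

Lemma class_wordK : cancel class_word word_class.
Proof. exact: reprK. Qed.

Lemma word_classK u : congr_closure R (class_word (word_class u)) u.
Proof. by apply/word_classP; rewrite class_wordK. Qed.

Definition pmul (x y : presented_monoid) : presented_monoid :=
  word_class (class_word x ++ class_word y).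

Lemma pmul_class u v : pmul (word_class u) (word_class v) = word_class (u ++ v).
Proof. by apply/word_classP/congr_cat; exact: word_classK. Qed.

Fact pmulA : associative pmul.
Proof.
move=> x y z; rewrite -(class_wordK x) -(class_wordK y) -(class_wordK z).
by rewrite !pmul_class catA.
Qed.

Fact pmul1 : left_id (word_class [::]) pmul.
Proof. by move=> x; rewrite -(class_wordK x) pmul_class. Qed.

Fact pmulr1 : right_id (word_class [::]) pmul.
Proof. by move=> x; rewrite -(class_wordK x) pmul_class cats0. Qed.

HB.instance Definition _ := isMonoid.Build presented_monoid pmulA pmul1 pmulr1.

Lemma word_class_cat u v : word_class (u ++ v) = word_class u * word_class v.
Proof. by rewrite -pmul_class. Qed.

Lemma word_class_nil : word_class [::] = 1.
Proof. by []. Qed.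

End PresentedMonoid.

Arguments word_class {X} R u.

(* The signed letter (x, true) stands for x and (x, false) for x^-1. *)
Definition positive_word (X : Type) (V : seq X) : seq (X * bool) :=
  [seq (x, true) | x <- V].

Definition formal_inv (X : Type) (w : seq (X * bool)) : seq (X * bool) :=
  rev [seq (x.1, ~~ x.2) | x <- w].

Inductive group_rel (X : Type) (R : seq X -> seq X -> Prop) :
    seq (X * bool) -> seq (X * bool) -> Prop :=
  | group_rel_cancel x b : group_rel R [:: (x, b); (x, ~~ b)] [::]
  | group_rel_pos V W : R V W ->
      group_rel R (formal_inv (positive_word V) ++ positive_word W) [::].

Section PresentedGroup.
Variables (X : choiceType) (R : seq X -> seq X -> Prop).

Definition presented_group : Type := presented_monoid (group_rel R).

HB.instance Definition _ := Monoid.on presented_group.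

Definition gword_class (w : seq (X * bool)) : presented_group :=
  word_class (group_rel R) w.

Lemma formal_inv_cat (u v : seq (X * bool)) :
  formal_inv (u ++ v) = formal_inv v ++ formal_inv u.
Proof. by rewrite /formal_inv map_cat rev_cat. Qed.

Lemma formal_invK : involutive (@formal_inv X).
Proof.
move=> w; rewrite /formal_inv map_rev revK -map_comp -[RHS]map_id.
by apply: eq_map => -[x b] /=; rewrite negbK.
Qed.

Lemma congr_formal_invl (w : seq (X * bool)) :
  congr_closure (group_rel R) (formal_inv w ++ w) [::].
Proof.
elim: w => [|[x b] w IHw]; first exact: congr_refl.
rewrite -[_ :: w]/([:: (x, b)] ++ w) formal_inv_cat -catA.
apply: congr_trans IHw; apply: congr_cat; first exact: congr_refl.
rewrite catA -[X in congr_closure _ _ X]cat0s; apply: congr_cat.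
  by rewrite -{2}[b]negbK; apply/congr_rel/group_rel_cancel.
exact: congr_refl.
Qed.

Lemma congr_formal_invr (w : seq (X * bool)) :
  congr_closure (group_rel R) (w ++ formal_inv w) [::].
Proof. by have := congr_formal_invl (formal_inv w); rewrite formal_invK. Qed.

Definition pinv (x : presented_group) : presented_group :=
  gword_class (formal_inv (class_word x)).

Fact pmulV : left_inverse (1 : presented_group) pinv *%g.
Proof.
move=> x; apply/word_classP/(congr_trans _ (congr_formal_invl (class_word x))).
by apply: congr_cat; [exact: word_classK | exact: congr_refl].
Qed.

Fact pmulrV : right_inverse (1 : presented_group) pinv *%g.
Proof.
move=> x; apply/word_classP/(congr_trans _ (congr_formal_invr (class_word x))).
by apply: congr_cat; [exact: congr_refl | exact: word_classK].
Qed.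

HB.instance Definition _ := hasInv.Build presented_group pinv.
HB.instance Definition _ := Monoid_isGroup.Build presented_group pmulV pmulrV.

Lemma gword_class_cat u v :
  gword_class (u ++ v) = gword_class u * gword_class v.
Proof. exact: word_class_cat. Qed.

Lemma gword_classP u v :
  gword_class u = gword_class v <-> congr_closure (group_rel R) u v.
Proof. exact: word_classP. Qed.

End PresentedGroup.

Arguments gword_class {X} R w.

(* Letter i : 'I_m.-1 is the standard generator sigma_(i+1) of B_m. *)
Inductive braid_rel (m : nat) : seq 'I_m.-1 -> seq 'I_m.-1 -> Prop :=
  | braid_rel_far (i j : 'I_m.-1) : i.+1 < j -> braid_rel [:: i; j] [:: j; i]
  | braid_rel_near (i j : 'I_m.-1) : j = i.+1 :> nat ->
      braid_rel [:: i; j; i] [:: j; i; j].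

Definition braid_group (m : nat) : groupType := presented_group (@braid_rel m).

Definition braid_gen (m : nat) (i : 'I_m.-1) : braid_group m :=
  gword_class (@braid_rel m) [:: (i, true)].

Section HurwitzAction.
Variables (G : groupType) (m : nat).
Implicit Types (g : m.-tuple G) (i : 'I_m.-1).

Definition sigma_act g i : m.-tuple G :=
  [tuple if k == i :> nat then nth 1 g i.+1
         else if k == i.+1 :> nat then nth 1 g i ^ nth 1 g i.+1
         else tnth g k | k < m].

Definition sigma_inv_act g i : m.-tuple G :=
  [tuple if k == i :> nat then nth 1 g i.+1 ^ (nth 1 g i)^-1
         else if k == i.+1 :> nat then nth 1 g i
         else tnth g k | k < m].

Definition letter_act g (x : 'I_m.-1 * bool) : m.-tuple G :=
  if x.2 then sigma_act g x.1 else sigma_inv_act g x.1.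

(* The action of a braid is computed on an arbitrary word representing it;
   hurwitz_act_class shows that the choice is immaterial. *)
Definition hurwitz_act g (beta : braid_group m) : m.-tuple G :=
  foldl letter_act g (class_word beta).

Lemma ltn_sigma i : i.+1 < m.
Proof. by case: i => i /=; case: m. Qed.

Lemma nth_sigma_act g i k :
  nth 1 (sigma_act g i) k =
  if k == i then nth 1 g i.+1
  else if k == i.+1 then nth 1 g i ^ nth 1 g i.+1 else nth 1 g k.
Proof.
have lt_i := ltn_sigma i; case: (ltnP k m) => [lt_k|le_k].
  by rewrite -[k]/(val (Ordinal lt_k)) nth_mktuple -tnth_nth.
rewrite ifN_eq ?ifN_eq ?(@nth_default _ _ _ k) ?size_tuple //.
  by apply: contraTneq le_k => ->; rewrite -ltnNge.
by apply: contraTneq le_k => ->; rewrite -ltnNge ltnW.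
Qed.

Lemma nth_sigma_inv_act g i k :
  nth 1 (sigma_inv_act g i) k =
  if k == i then nth 1 g i.+1 ^ (nth 1 g i)^-1
  else if k == i.+1 then nth 1 g i else nth 1 g k.
Proof.
have lt_i := ltn_sigma i; case: (ltnP k m) => [lt_k|le_k].
  by rewrite -[k]/(val (Ordinal lt_k)) nth_mktuple -tnth_nth.
rewrite ifN_eq ?ifN_eq ?(@nth_default _ _ _ k) ?size_tuple //.
  by apply: contraTneq le_k => ->; rewrite -ltnNge.
by apply: contraTneq le_k => ->; rewrite -ltnNge ltnW.
Qed.

Lemma eq_from_nth1 g g' : (forall k, nth 1 g k = nth 1 g' k) -> g = g'.
Proof. by move=> eq_g; apply: eq_from_tnth => k; rewrite !(tnth_nth 1). Qed.

Lemma sigma_actK i : cancel (sigma_act^~ i) (sigma_inv_act^~ i).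
Proof.
move=> g; apply: eq_from_nth1 => k.
rewrite nth_sigma_inv_act !nth_sigma_act !eqxx.
have -> : (i.+1 == i) = false by rewrite gtn_eqF.
case: eqP => [->|_]; first by rewrite conjgK.
by case: eqP => [->|].
Qed.

Lemma sigma_inv_actK i : cancel (sigma_inv_act^~ i) (sigma_act^~ i).
Proof.
move=> g; apply: eq_from_nth1 => k.
rewrite nth_sigma_act !nth_sigma_inv_act !eqxx.
have -> : (i.+1 == i) = false by rewrite gtn_eqF.
case: eqP => [->|_] //.
by case: eqP => [->|] //; rewrite conjgKV.
Qed.

Lemma letter_actK x b :
  cancel (letter_act^~ (x, b)) (letter_act^~ (x, ~~ b)).
Proof. by case: b; [exact: sigma_actK | exact: sigma_inv_actK]. Qed.

Lemma sigma_act_far g (i j : 'I_m.-1) : i.+1 < j ->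
  sigma_act (sigma_act g i) j = sigma_act (sigma_act g j) i.
Proof.
move=> lt_ij; apply: eq_from_nth1 => k; rewrite !nth_sigma_act.
have [-> -> -> ->] : [/\ j == i :> nat = false, j == i.+1 :> nat = false,
    j.+1 == i = false & j.+1 == i.+1 = false].
  by split; apply/eqP; lia.
have [-> -> -> ->] : [/\ i == j :> nat = false, i == j.+1 :> nat = false,
    i.+1 == j = false & i.+1 == j.+1 = false].
  by split; apply/eqP; lia.
by do !case: eqP => //; lia.
Qed.

Lemma sigma_act_near g (i j : 'I_m.-1) : j = i.+1 :> nat ->
  sigma_act (sigma_act (sigma_act g i) j) i =
  sigma_act (sigma_act (sigma_act g j) i) j.
Proof.
move=> def_j; apply: eq_from_nth1 => k; rewrite !nth_sigma_act def_j !eqxx.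
have [-> -> ->] : [/\ (i.+1 == i) = false, (i.+2 == i) = false &
   (i.+2 == i.+1) = false] by split; apply/eqP; lia.
have [-> ->] : (i == i.+1 :> nat) = false /\ (i == i.+2 :> nat) = false.
  by split; apply/eqP; lia.
case: (k =P i.+1) => [->|_]; first by rewrite gtn_eqF.
case: (k =P i.+2) => [->|_]; first by rewrite gtn_eqF 1?ltnW // conjJg.
by case: eqP.
Qed.

Lemma foldl_formal_inv g w :
  foldl letter_act (foldl letter_act g w) (formal_inv w) = g.
Proof.
elim: w g => [|[x b] w IHw] g //=.
rewrite -[_ :: w]/([:: (x, b)] ++ w) formal_inv_cat foldl_cat IHw /=.
exact: letter_actK.
Qed.

Lemma foldl_letter_act_congr g u v :
  congr_closure (group_rel (@braid_rel m)) u v ->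
  foldl letter_act g u = foldl letter_act g v.
Proof.
move=> uv; elim: uv g => {u v} [u v uv|//|u v _ IH|u v w _ IH1 _ IH2
  |u u' v v' _ IH1 _ IH2] g; last by rewrite !foldl_cat IH1 IH2.
- case: uv => [x b|V W VW] /=; first exact: letter_actK.
  suff VW_act h : foldl letter_act h (positive_word W) =
                  foldl letter_act h (positive_word V).
    rewrite foldl_cat VW_act.
    have := foldl_formal_inv g (formal_inv (positive_word V)).
    by rewrite formal_invK.
  case: VW => i j ij /=; rewrite /letter_act /=.
    by rewrite (sigma_act_far _ ij).
  by rewrite (sigma_act_near _ ij).
- by rewrite IH.
- by rewrite IH1 IH2.
Qed.

Lemma hurwitz_act_class g w :
  hurwitz_act g (gword_class (@braid_rel m) w) = foldl letter_act g w.
Proof. exact/foldl_letter_act_congr/word_classK. Qed.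

Lemma hurwitz_act_gen g i : hurwitz_act g (braid_gen i) = sigma_act g i.
Proof. by rewrite hurwitz_act_class. Qed.

Lemma hurwitz_act1 g : hurwitz_act g 1 = g.
Proof. exact: (hurwitz_act_class g [::]). Qed.

Lemma hurwitz_actM g b c :
  hurwitz_act g (b * c) = hurwitz_act (hurwitz_act g b) c.
Proof.
by rewrite -(class_wordK b) -(class_wordK c) -gword_class_cat
   !hurwitz_act_class foldl_cat.
Qed.

Definition conj_act g (x : G) : m.-tuple G := [tuple of [seq y ^ x | y <- g]].

Lemma nth_conj_act g x k : nth 1 (conj_act g x) k = nth 1 g k ^ x.
Proof.
have [lt_k|le_k] := ltnP k m; first by rewrite (nth_map 1) ?size_tuple.
by rewrite !nth_default ?size_map ?size_tuple // conj1g.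
Qed.

Lemma conj_hurwitz_act g x b :
  hurwitz_act (conj_act g x) b = conj_act (hurwitz_act g b) x.
Proof.
rewrite -(class_wordK b) !hurwitz_act_class.
elim: (class_word b) g => //= -[i c] w IHw g; rewrite -IHw; congr (foldl _ _ _).
apply: eq_from_nth1 => k; rewrite /letter_act nth_conj_act /=; case: c.
  rewrite !nth_sigma_act !nth_conj_act -conjJg.
  by case: eqP => // _; case: eqP.
rewrite !nth_sigma_inv_act !nth_conj_act -conjVg -conjJg.
by case: eqP => // _; case: eqP.
Qed.

End HurwitzAction.

(* A G-system of length m is a sequence of size m. Both relations force
   size a = size b, because hurwitz_act preserves the length. *)
Definition hurwitz_equiv (G : groupType) (a b : seq G) : Prop :=
  exists beta : braid_group (size a),
    hurwitz_act (in_tuple a) beta = b :> seq G.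

Definition hc_equiv (G : groupType) (a b : seq G) : Prop :=
  exists (x : G) (beta : braid_group (size a)),
    hurwitz_act (conj_act (in_tuple a) x) beta = b :> seq G.

Definition coxeter (G : groupType) (a : seq G) : G := \prod_(x <- a) x.

Definition conjugate (G : groupType) (x y : G) : Prop := exists g, y = x ^ g.

Section Garside.
Variable M : monoidType.
Implicit Types (x y z : M) (A : M -> Prop).

Definition ldivides x y : Prop := exists z, y = x * z.
Definition rdivides x y : Prop := exists z, y = z * x.

Definition atom x : Prop := x <> 1 /\ forall y z, x = y * z -> y = 1 \/ z = 1.

Definition finitely_many A : Prop := exists s : seq M, forall x, A x -> x \in s.

Definition product_of A (s : seq M) x : Prop :=
  (forall y, y \in s -> A y) /\ \prod_(y <- s) y = x.

Definition generates A : Prop := forall x, exists s, product_of A s x.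

Definition has_gcd (div : M -> M -> Prop) : Prop :=
  forall x y, exists d, [/\ div d x, div d y &
    forall z, div z x -> div z y -> div z d].

Definition has_lcm (div : M -> M -> Prop) : Prop :=
  forall x y, exists e, [/\ div x e, div y e &
    forall z, div x z -> div y z -> div e z].

(* gm_atoms_gen and gm_atoms_bounded force 1 to be the only invertible element. *)
Record garside_monoid (Delta : M) : Prop := GarsideMonoid {
  gm_mulI : forall x y z, x * y = x * z -> y = z;
  gm_mulIg : forall x y z, y * x = z * x -> y = z;
  gm_atoms_gen : generates atom;
  gm_atoms_fin : finitely_many atom;
  gm_atoms_bounded :
    forall x, exists N, forall s, product_of atom s x -> size s <= N;
  gm_lgcd : has_gcd ldivides;
  gm_llcm : has_lcm ldivides;
  gm_rgcd : has_gcd rdivides;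
  gm_rlcm : has_lcm rdivides;
  gm_Delta_balanced : forall x, ldivides x Delta <-> rdivides x Delta;
  gm_Delta_fin : finitely_many (fun x => ldivides x Delta);
  gm_Delta_gen : generates (fun x => ldivides x Delta)
}.

End Garside.

(* Right fractions suffice: in a Garside monoid common left and right multiples
   exist, so that right fractions are also left fractions. *)
Definition group_of_fractions (G : groupType) (M : monoidType) (i : M -> G) :
    Prop :=
  [/\ monoid_morphism i, injective i & forall g, exists x y, g = i x / i y].

(* i is the inclusion of M in its group of fractions G. *)
Record garside_group (G : groupType) (M : monoidType) (i : M -> G)
    (Delta : M) : Prop := GarsideGroup {
  gg_monoid : garside_monoid Delta;
  gg_fractions : group_of_fractions i
}.

Record positive_presentation := PositivePresentation {
  letters : finType;
  relations : seq (seq letters * seq letters)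
}.

Definition is_relation (P : positive_presentation) (V W : seq (letters P)) :
  Prop := (V, W) \in relations P.

Definition assoc_monoid (P : positive_presentation) : monoidType :=
  presented_monoid (@is_relation P).

Definition assoc_group (P : positive_presentation) : groupType :=
  presented_group (@is_relation P).

Section Presentation.
Variables (G : groupType) (P : positive_presentation) (gen : letters P -> G).

(* The natural map from the presented group is an isomorphism onto G. *)
Definition presents : Prop :=
  exists f : assoc_group P -> G,
    [/\ monoid_morphism f,
        forall s, f (gword_class (@is_relation P) [:: (s, true)]) = gen s
      & bijective f].

(* The natural map from the associated monoid is an isomorphism onto i(M). *)
Definition is_assoc_monoid (M : monoidType) (i : M -> G) : Prop :=
  exists f : assoc_monoid P -> G,
    [/\ monoid_morphism f,
        forall s, f (word_class (@is_relation P) [:: s]) = gen s,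
        injective f
      & forall g, (exists w, f w = g) <-> (exists x, i x = g)].

(* hurwitz_equiv forces size V = size W. *)
Definition hurwitz_compatible (V W : seq (letters P)) : Prop :=
  hurwitz_equiv (map gen V) (map gen W).

End Presentation.

(* Main.v *)
Require Import Defs.
From mathcomp Require Import all_boot.
From mathcomp Require Import zify.

(** The element u divides v when v = u * w, C(a) denotes the Coxeter element of
    a system a, and Delta-conjugation is written x |-> x ^ Delta.

    Part (1).  A Hurwitz move replaces x * y by y * x ^ y, so it fixes the
    Coxeter element.  Conversely, if C(a) = C(a') then the words a and a' are
    equal in M, which is the associated monoid, so they are joined by relations
    applied inside words.  Each relation is realized by a braid on the strands
    it touches, hence by a braid on the whole word (coxeter_gen_inj).

    Part (2).  Two kinds of conjugation of the Coxeter element are realized by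
    HC-equivalences of generator systems.  If C(a) = x y and C(b) = y x with
    x, y in M, then by part (1) a and b may be taken to be concatenations of
    words for x and y, and the two concatenations are HC-equivalent
    (hc_equiv_cycle).  And since conjugation by Delta permutes the atoms, the
    conjugate of a generator system by Delta is a generator system
    (conj_Delta_gen).  What must be shown is that these two steps connect any
    two conjugate Coxeter elements, provided that one is divisible by Delta.

    So let d = C(a) be divisible by Delta and let c = C(b) be conjugate to d.
    After conjugating d by a power of Delta, which keeps it divisible by Delta,
    the conjugator is an element h of M: c h = h d.  The proof descends on h
    (hc_equiv_positive_conj).  As h Delta is in Delta M, Delta divides c h, so
    the right lcm of c and Delta, which has the form c y = Delta z, divides c h
    and therefore y divides h.  It also divides c Delta, so y y' = Delta for
    some y' (Delta_complement).
    - If y <> 1, then c ^ y = y' z, because y y' z = c y, and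
      c ^ Delta = z y', because c Delta = c y y' = Delta z y'.  Hence a
      conjugation by Delta followed by a cyclic shift leads from c to c ^ y,
      and what is left of h after removing y is shorter.
    - If y = 1, then Delta divides c.  Any divisor u <> 1 of Delta dividing h
      divides c as well, so that c ^ u is a cyclic shift of c, and u can be
      removed from h.
    When h = 1 the Coxeter elements agree and part (1) applies.

    Only c, not d, changes during the descent, so the divisibility of d by
    Delta is available at every step even if c is never divisible by Delta. *)

Set Implicit Arguments.
Unset Strict Implicit.
Unset Printing Implicit Defensive.

Local Open Scope group_scope.

(** * Hurwitz and HC-equivalence in a group *)

Section HurwitzEquivalence.
Variable G : groupType.
Implicit Types (x y : G) (a b c l r : seq G).

(** Frees the number of strands from the form size a, so that it does not have
    to be transported when one system is replaced by another. *)
Lemma hurwitz_equivE m (g : m.-tuple G) b :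
  hurwitz_equiv g b <->
  exists beta : braid_group m, hurwitz_act g beta = b :> seq G.
Proof.
case: g => s /= eq_s; have def_m := eqP eq_s; case: m / def_m eq_s => eq_s.
by rewrite /hurwitz_equiv (_ : in_tuple s = Tuple eq_s) //; apply: val_inj.
Qed.

Lemma hurwitz_equiv_refl a : hurwitz_equiv a a.
Proof. by exists 1; rewrite hurwitz_act1. Qed.

Lemma hurwitz_equiv_sym a b : hurwitz_equiv a b -> hurwitz_equiv b a.
Proof.
case=> beta <-; apply/hurwitz_equivE; exists beta^-1.
by rewrite -hurwitz_actM mulgV hurwitz_act1.
Qed.

Lemma hurwitz_equiv_trans a b c :
  hurwitz_equiv a b -> hurwitz_equiv b c -> hurwitz_equiv a c.
Proof.
case=> beta <- /hurwitz_equivE[gamma <-].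
by exists (beta * gamma); rewrite hurwitz_actM.
Qed.

Lemma sigma_act_move m (g : m.-tuple G) (j : 'I_m.-1) :
  sigma_act g j = take j g ++ nth 1 g j.+1 :: nth 1 g j ^ nth 1 g j.+1
                  :: drop j.+2 g :> seq G.
Proof.
have lt_j := ltn_sigma j; have lt_j1 := ltnW lt_j.
apply: (@eq_from_nth _ 1) => [|k _].
  by rewrite size_cat /= size_take size_drop !size_tuple lt_j1 card_ord; lia.
rewrite nth_sigma_act nth_cat size_take size_tuple lt_j1.
case: ltngtP => [lt_kj|lt_jk|->]; last by rewrite subnn.
  by rewrite nth_take // ltn_eqF // ltnW.
case: eqP => [->|ne_k]; first by rewrite subSnn.
have -> : (k - j)%N = (k - j.+2).+2 by lia.
by rewrite /= nth_drop; congr nth; lia.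
Qed.

Lemma cat_take_drop2 m (g : m.-tuple G) (j : 'I_m.-1) :
  take j g ++ nth 1 g j :: nth 1 g j.+1 :: drop j.+2 g = g.
Proof.
have lt_j := ltn_sigma j.
by rewrite -!drop_nth ?size_tuple ?cat_take_drop // ltnW.
Qed.

Lemma hurwitz_move l r x y :
  hurwitz_equiv (l ++ x :: y :: r) (l ++ y :: x ^ y :: r).
Proof.
set a := l ++ x :: y :: r.
have lt_l : size l < (size a).-1 by rewrite size_cat /=; lia.
exists (braid_gen (Ordinal lt_l)); rewrite hurwitz_act_gen sigma_act_move /=.
by rewrite take_size_cat // !nth_cat ltnn subnn ltnNge leqnSn /= subSnn /=
   drop_cat ltnNge leqW //= ?subSn ?leqnSn ?subnn //= drop0.
Qed.

(** Hurwitz equivalence is generated by the moves of the standard generators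
    at arbitrary positions.  This is how the later arguments avoid braids: an
    invariance has only to be checked on one move. *)
Lemma hurwitz_equiv_least (E : seq G -> seq G -> Prop) :
    (forall a, E a a) -> (forall a b, E a b -> E b a) ->
    (forall a b c, E a b -> E b c -> E a c) ->
    (forall l r x y, E (l ++ x :: y :: r) (l ++ y :: x ^ y :: r)) ->
  forall a b, hurwitz_equiv a b -> E a b.
Proof.
move=> Er Es Et Em a b [beta <-]; rewrite -(class_wordK beta) hurwitz_act_class.
have Esig m (g : m.-tuple G) j : E g (sigma_act g j).
  by rewrite sigma_act_move -{1}(cat_take_drop2 g j); apply: Em.
rewrite -{1}[a]/(tval (in_tuple a)).
elim: (class_word beta) (in_tuple a) => [|[j e] w IHw] g //=.
apply: Et (IHw _); rewrite /letter_act /=; case: e => //.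
by apply: Es; rewrite -{2}(sigma_inv_actK j g).
Qed.

(** Braids on adjacent groups of strands can be juxtaposed. *)
Lemma hurwitz_equiv_cat a a' b b' :
  hurwitz_equiv a a' -> hurwitz_equiv b b' -> hurwitz_equiv (a ++ b) (a' ++ b').
Proof.
move=> Ha Hb; apply: (@hurwitz_equiv_trans _ (a' ++ b)).
  move: a a' Ha; apply: hurwitz_equiv_least => [a|a c|a c d|l r x y].
  - exact: hurwitz_equiv_refl.
  - exact: hurwitz_equiv_sym.
  - exact: hurwitz_equiv_trans.
  - by rewrite -!catA; apply: hurwitz_move.
move: b b' Hb; apply: hurwitz_equiv_least => [b|b c|b c d|l r x y].
- exact: hurwitz_equiv_refl.
- exact: hurwitz_equiv_sym.
- exact: hurwitz_equiv_trans.
- by rewrite !catA; apply: hurwitz_move.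
Qed.

Lemma coxeter_cat a b : coxeter (a ++ b) = coxeter a * coxeter b.
Proof. exact: big_cat. Qed.

Lemma coxeter_hurwitz_equiv a b : hurwitz_equiv a b -> coxeter a = coxeter b.
Proof.
move: a b; apply: hurwitz_equiv_least => [//|//|a b c -> //|l r x y].
by rewrite /coxeter !big_cat !big_cons /= [x * _]mulgA [y * (_ * _)]mulgA -conjgC.
Qed.

Lemma hurwitz_equiv_conj x a b :
  hurwitz_equiv a b -> hurwitz_equiv [seq y ^ x | y <- a] [seq y ^ x | y <- b].
Proof.
case=> beta <-; apply/(@hurwitz_equivE _ (conj_act (in_tuple a) x)).
by exists beta; rewrite conj_hurwitz_act.
Qed.

Lemma coxeter_conj x a : coxeter [seq y ^ x | y <- a] = coxeter a ^ x.
Proof.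
rewrite /coxeter; elim: a => [|y a IHa] /=; first by rewrite !big_nil conj1g.
by rewrite !big_cons IHa conjMg.
Qed.

(** The last entry travels to the front unchanged and conjugates the entries
    that it passes. *)
Lemma hurwitz_rot1 x a : hurwitz_equiv (a ++ [:: x]) (x :: [seq y ^ x | y <- a]).
Proof.
elim: a => [|z a IHa]; first exact: hurwitz_equiv_refl.
apply: hurwitz_equiv_trans (hurwitz_move [::] _ z x).
exact: (hurwitz_equiv_cat (hurwitz_equiv_refl [:: z]) IHa).
Qed.

Lemma hc_equivE a b :
  hc_equiv a b <-> exists x, hurwitz_equiv [seq y ^ x | y <- a] b.
Proof.
split=> [] [x Hx]; exists x.
  exact/(@hurwitz_equivE _ (conj_act (in_tuple a) x)).
exact/(@hurwitz_equivE _ (conj_act (in_tuple a) x)).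
Qed.

Lemma map_conjg1 a : [seq y ^ 1 | y <- a] = a.
Proof. by under eq_map do rewrite conjg1; rewrite map_id. Qed.

Lemma map_conjgM x y a :
  [seq z ^ (x * y) | z <- a] =
  [seq z ^ y | z <- [seq z ^ x | z <- a]].
Proof. by rewrite -map_comp; apply: eq_map => z /=; rewrite conjgM. Qed.

Lemma hurwitz_hc_equiv a b : hurwitz_equiv a b -> hc_equiv a b.
Proof. by move=> ab; apply/hc_equivE; exists 1; rewrite map_conjg1. Qed.

Lemma hc_equiv_conj x a : hc_equiv a [seq y ^ x | y <- a].
Proof. by apply/hc_equivE; exists x; apply: hurwitz_equiv_refl. Qed.

Lemma hc_equiv_sym a b : hc_equiv a b -> hc_equiv b a.
Proof.
move=> /hc_equivE[x ab]; apply/hc_equivE; exists x^-1.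
apply: hurwitz_equiv_sym; have := hurwitz_equiv_conj x^-1 ab.
by rewrite -map_conjgM mulgV map_conjg1.
Qed.

Lemma hc_equiv_trans a b c : hc_equiv a b -> hc_equiv b c -> hc_equiv a c.
Proof.
move=> /hc_equivE[x ab] /hc_equivE[y bc]; apply/hc_equivE; exists (x * y).
by rewrite map_conjgM; apply: hurwitz_equiv_trans bc; apply: hurwitz_equiv_conj.
Qed.

(** The last entry x of a ++ [:: x] moves to the front by a braid, which yields
    the conjugate of x :: a by x; so a cyclic shift by one entry is an
    HC-equivalence. *)
Lemma hc_equiv_rot a b : hc_equiv (a ++ b) (b ++ a).
Proof.
elim: a b => [|x a IHa] b.
  by rewrite cats0; apply/hurwitz_hc_equiv/hurwitz_equiv_refl.
have := IHa (b ++ [:: x]); rewrite -catA; apply: hc_equiv_trans.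
rewrite catA; apply: hc_equiv_trans (hc_equiv_conj x _) _.
rewrite /= [x ^ x]conjgE mulKg.
exact/hurwitz_hc_equiv/hurwitz_equiv_sym/hurwitz_rot1.
Qed.

Lemma coxeter_hc_equiv a b : hc_equiv a b -> conjugate (coxeter a) (coxeter b).
Proof.
by move=> /hc_equivE[x /coxeter_hurwitz_equiv <-]; exists x; rewrite coxeter_conj.
Qed.

End HurwitzEquivalence.

(** * Divisibility in a Garside monoid *)

Section GarsideMonoid.
Variables (M : monoidType) (Delta : M).
Hypothesis gM : garside_monoid Delta.
Implicit Types (x y z c h k : M).

Let mulI := gm_mulI gM.
Let mulIg := gm_mulIg gM.

Lemma generated_ind (A : M -> Prop) (Q : M -> Prop) :
    generates A -> Q 1 -> (forall x y, A x -> Q y -> Q (x * y)) ->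
  forall x, Q x.
Proof.
move=> genA Q1 QM x; have [s [As <-]] := genA x.
elim: s As => [|y s IHs] As; first by rewrite big_nil.
rewrite big_cons; apply: QM; first by apply: As; rewrite mem_head.
by apply: IHs => z zs; apply: As; rewrite in_cons zs orbT.
Qed.

(** If s t = Delta, then t also divides Delta on the left, say t r = Delta, and
    s Delta = s t r = Delta r; divisors of Delta generate M. *)
Lemma Delta_swapl x : exists x', x * Delta = Delta * x'.
Proof.
move: x; apply: (generated_ind (gm_Delta_gen gM)) => [|s x [t def_D] [x' IHx]].
  by exists 1; rewrite mul1g mulg1.
have [r def_r]: ldivides t Delta by apply/(gm_Delta_balanced gM); exists s.
by exists (r * x'); rewrite -mulgA IHx mulgA {1}def_r mulgA -def_D mulgA.
Qed.

Lemma Delta_swapr x : exists x', Delta * x = x' * Delta.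
Proof.
move: x; apply: (generated_ind (gm_Delta_gen gM)) => [|s x sD [x' IHx]].
  by exists 1; rewrite mul1g mulg1.
have [t def_D] := (gm_Delta_balanced gM s).1 sD.
have [r def_r]: rdivides t Delta by apply/(gm_Delta_balanced gM); exists s.
by exists (r * x'); rewrite mulgA {1}def_r -[r * t * s]mulgA -def_D -mulgA IHx mulgA.
Qed.

(** Conjugation by Delta maps M onto itself by the two lemmas above, so it
    preserves irreducibility. *)
Lemma atom_Delta_swap x : atom x -> exists2 y, atom y & x * Delta = Delta * y.
Proof.
case=> x_neq1 irr_x; have [y def_y] := Delta_swapl x; exists y => //; split.
  by move=> y1; case: x_neq1; apply: (@mulIg Delta); rewrite def_y y1 mulg1 mul1g.
move=> p q def_pq; have [p' def_p] := Delta_swapr p.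
have [q' def_q] := Delta_swapr q.
have: x = p' * q'.
  by apply: (@mulIg Delta); rewrite def_y def_pq mulgA def_p -!mulgA def_q.
move/irr_x=> [] E; [left | right]; apply: (@mulI Delta);
  by rewrite ?def_p ?def_q E mul1g mulg1.
Qed.

Lemma ldivides_Delta_exp x : exists n, ldivides x (Delta ^+ n).
Proof.
move: x; apply: (generated_ind (gm_Delta_gen gM)) => [|s x [t def_D] [n [x' IHx]]].
  by exists 0, 1; rewrite mulg1.
have [t' def_t] : exists t', t * Delta ^+ n = Delta ^+ n * t'.
  elim: n {IHx} => [|n [t' IHn]]; first by exists t; rewrite mulg1 mul1g.
  have [t2 def_t2] := Delta_swapl t'; exists t2.
  by rewrite expgSr mulgA IHn -!mulgA def_t2.
by exists n.+1, (x' * t'); rewrite expgS {1}def_D -mulgA def_t IHx !mulgA.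
Qed.

(** In an expression of h as a product of divisors of Delta, some factor differs
    from 1, and the first such factor can serve as u. *)
Lemma ldivides_Delta_factor h : h <> 1 ->
  exists u k, [/\ h = u * k, u <> 1 & ldivides u Delta].
Proof.
move: h; apply: (generated_ind (gm_Delta_gen gM)) => [//|s x sD IHx] sx_neq1.
have [s1|/eqP s_neq1] := eqVneq s 1; last by exists s, x.
by move: sx_neq1; rewrite s1 mul1g.
Qed.

(** Descent on right factors is well-founded: the bound on the lengths of atomic
    expressions drops when a factor y <> 1 is removed. *)
Lemma garside_ind (Q : M -> Prop) :
    (forall h, (forall y k, h = y * k -> y <> 1 -> Q k) -> Q h) ->
  forall h, Q h.
Proof.
move=> IH h; have [N leN] := gm_atoms_bounded gM h.
elim: N h leN => [|N IHN] h leN; apply: IH => y k def_h y_neq1.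
  case: y_neq1; have [s [As def_y]] := gm_atoms_gen gM y.
  have [t [At def_k]] := gm_atoms_gen gM k.
  have: size (s ++ t) <= 0.
    apply: leN; split=> [z|]; last by rewrite big_cat /= def_y def_k.
    by rewrite mem_cat => /orP[/As|/At].
  by case: s def_y {As} => //; rewrite big_nil.
apply: IHN => t [At def_k]; have [s [As def_y]] := gm_atoms_gen gM y.
have: size (s ++ t) <= N.+1.
  apply: leN; split=> [z|]; last by rewrite big_cat /= def_y def_k.
  by rewrite mem_cat => /orP[/As|/At].
case: s def_y {As} => [|z s _]; first by rewrite big_nil => /esym.
by rewrite /= ltnS size_cat; apply: leq_trans; apply: leq_addl.
Qed.

(** The element c y = Delta z is the right lcm of c and Delta; it divides both of
    the common multiples c h and c Delta, which gives y | h and y | Delta. *)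
Lemma Delta_complement c h x : c * h = Delta * x ->
  exists y k y' z, [/\ h = y * k, y * y' = Delta & c * y = Delta * z].
Proof.
move=> def_ch; have [_ [[y ->] [z def_cy] min_e]] := gm_llcm gM c Delta.
have [k def_k] : ldivides (c * y) (c * h) by apply: min_e; [exists h | exists x].
have [c' def_c'] := Delta_swapl c.
have [y' def_y'] : ldivides (c * y) (c * Delta).
  by apply: min_e; [exists Delta | exists c'].
exists y, k, y', z; split=> //; apply: (@mulI c); first by rewrite def_k mulgA.
by rewrite def_y' mulgA.
Qed.

End GarsideMonoid.

(** * Generator systems *)

Section GeneratorSystems.
Variables (G : groupType) (M : monoidType) (i : M -> G) (Delta : M).
Hypothesis garsideG : garside_group i Delta.
Variables (P : positive_presentation) (gen : letters P -> G).
Hypothesis assocM : is_assoc_monoid gen i.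
Hypothesis compatP : forall V W : seq (letters P),
  is_relation V W -> hurwitz_compatible gen V W.
Hypothesis gen_atoms : forall g : G,
  (exists s : letters P, gen s = g) <-> (exists2 x : M, atom x & i x = g).
Implicit Types (a b w : seq (letters P)) (x y z : M).

Let gM := gg_monoid garsideG.

Let i1 : i 1 = 1. Proof. by case: garsideG => _ [[]]. Qed.
Let iM x y : i (x * y) = i x * i y.
Proof. by case: garsideG => _ [[_ ->]]. Qed.
Let i_inj : injective i. Proof. by case: garsideG => _ []. Qed.

Let C w := coxeter (map gen w).

(** Hurwitz equivalence is itself a congruence on words, by juxtaposition of
    braids; so it suffices that it contains the relations. *)
Lemma congr_hurwitz_equiv V W :
  congr_closure (@is_relation P) V W -> hurwitz_equiv (map gen V) (map gen W).
Proof.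
elim=> {V W} [V W /compatP //|V|V W _|V W w _ H1 _ H2|V V' W W' _ H1 _ H2].
- exact: hurwitz_equiv_refl.
- exact: hurwitz_equiv_sym.
- exact: hurwitz_equiv_trans H1 H2.
- by rewrite !map_cat; apply: hurwitz_equiv_cat.
Qed.

Lemma assoc_monoid_morphE (f : assoc_monoid P -> G) :
    monoid_morphism f ->
    (forall s, f (word_class (@is_relation P) [:: s]) = gen s) ->
  forall w, f (word_class (@is_relation P) w) = C w.
Proof.
move=> [f1 fM] fgen; rewrite /C /coxeter; elim=> [|s w IHw].
  by rewrite big_nil -[RHS]f1.
by rewrite -cat1s word_class_cat fM fgen IHw big_cons.
Qed.

Lemma coxeter_gen_inj a b : C a = C b -> hurwitz_equiv (map gen a) (map gen b).
Proof.
have [f [fm fgen f_inj _]] := assocM => eqC; apply/congr_hurwitz_equiv.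
by apply/word_classP/f_inj; rewrite !(assoc_monoid_morphE fm fgen).
Qed.

Lemma coxeter_gen_onto x : exists w, C w = i x.
Proof.
have [f [fm fgen _ fim]] := assocM.
have [v <-] : exists v, f v = i x by apply/fim; exists x.
by exists (class_word v); rewrite -(assoc_monoid_morphE fm fgen) class_wordK.
Qed.

Lemma coxeter_gen_in w : exists x, i x = C w.
Proof.
have [f [fm fgen _ fim]] := assocM; apply/fim.
by exists (word_class (@is_relation P) w); rewrite (assoc_monoid_morphE fm fgen).
Qed.

(** By coxeter_gen_inj the two systems may be taken to be v ++ w and w ++ v, with
    words v and w for x and y. *)
Lemma hc_equiv_cycle a b x y : C a = i (x * y) -> C b = i (y * x) ->
  hc_equiv (map gen a) (map gen b).
Proof.
have [[v Cv] [w Cw]] := (coxeter_gen_onto x, coxeter_gen_onto y).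
rewrite !iM -Cv -Cw -!coxeter_cat -!map_cat.
move=> /coxeter_gen_inj/hurwitz_hc_equiv Ha /coxeter_gen_inj/hurwitz_hc_equiv Hb.
apply: hc_equiv_trans Ha (hc_equiv_trans _ (hc_equiv_sym Hb)).
by rewrite !map_cat; apply: hc_equiv_rot.
Qed.

Lemma conj_Delta_gen a : exists b, map gen b = [seq g ^ i Delta | g <- map gen a].
Proof.
elim: a => [|s a [b IHa]]; first by exists [::].
have [|x at_x def_x] := (gen_atoms (gen s)).1; first by exists s.
have [y at_y def_y] := atom_Delta_swap gM at_x.
have [|t def_t] := (gen_atoms (i y)).2; first by exists y.
exists (t :: b); rewrite /= IHa def_t -def_x; congr (_ :: _).
by rewrite conjgE -iM def_y iM mulKg.
Qed.

(** Everything but h is generalized in the induction, since each step replaces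
    b by an HC-equivalent system; a and d stay the same.  The case split is
    on y from Delta_complement, as explained at the top. *)
Lemma hc_equiv_positive_conj c d h k a b :
    C b = i c -> C a = i d -> d = Delta * k -> c * h = h * d ->
  hc_equiv (map gen b) (map gen a).
Proof.
move: h c d k a b; apply: (garside_ind gM) => h IHh c d k a b Cb Ca def_d def_ch.
have [h1|/eqP h_neq1] := eqVneq h 1.
  apply/hurwitz_hc_equiv/coxeter_gen_inj; rewrite Ca Cb; congr i.
  by rewrite -[c]mulg1 -{1}h1 def_ch h1 mul1g.
have [h' def_h'] := Delta_swapl gM h.
have def_ch' : c * h = Delta * (h' * k) by rewrite def_ch def_d !mulgA def_h'.
have [y [k' [y' [z [def_h def_D def_cy]]]]] := Delta_complement gM def_ch'.
have [y1|/eqP y_neq1] := eqVneq y 1.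
  (* Delta divides c: shift a divisor u of Delta and h around c. *)
  move: def_cy; rewrite y1 mulg1 => def_c.
  have [u [h2 [def_h2 u_neq1 [u' def_u]]]] := ldivides_Delta_factor gM h_neq1.
  have [w Cw] := coxeter_gen_onto (u' * z * u).
  apply: (@hc_equiv_trans _ _ (map gen w)).
    by apply: (@hc_equiv_cycle _ _ u (u' * z)); rewrite ?Cb ?Cw // def_c def_u mulgA.
  apply: (IHh u h2 def_h2 u_neq1 (u' * z * u) d k) => //.
  by apply: (gm_mulI gM (x := u)); rewrite !mulgA -def_u -def_c -[LHS]mulgA -def_h2.
(* b is linked to its Delta-conjugate b', whose Coxeter element is z y', and
   b' to a system w1 with Coxeter element y' z = c ^ y. *)
have [w1 Cw1] := coxeter_gen_onto (y' * z).
have [w2 Cw2] := coxeter_gen_onto (z * y').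
have [b' def_b'] := conj_Delta_gen b.
apply: (@hc_equiv_trans _ _ (map gen w1)); last first.
  apply: (IHh y k' def_h y_neq1 (y' * z) d k) => //.
  by apply: (gm_mulI gM (x := y)); rewrite !mulgA def_D -def_cy -[LHS]mulgA -def_h.
apply: (@hc_equiv_trans _ _ (map gen b')).
  by rewrite def_b'; apply: hc_equiv_conj.
apply: (@hc_equiv_trans _ _ (map gen w2)); last exact: hc_equiv_cycle Cw2 Cw1.
apply/hurwitz_hc_equiv/coxeter_gen_inj.
rewrite Cw2 /C def_b' coxeter_conj -/(C b) Cb conjgE -iM.
have -> : c * Delta = Delta * (z * y') by rewrite -{1}def_D mulgA def_cy mulgA.
by rewrite iM mulKg.
Qed.

(** The conjugator x / y from C(b) to C(a) becomes positive after multiplication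
    by a power of Delta that y divides; this power is absorbed by conjugating
    a. *)
Lemma hc_equiv_conjugate a b k : C a = i (Delta * k) ->
  conjugate (C a) (C b) -> hc_equiv (map gen a) (map gen b).
Proof.
move=> Ca [g Cb]; apply: hc_equiv_sym.
have [_ [_ _ frac]] := garsideG; have [x [y def_g]] := frac g^-1.
have [n [y' def_D]] := ldivides_Delta_exp gM y.
have [a' [k' [def_a' Ca']]] : exists a' k',
    map gen a' = [seq u ^ (i Delta ^+ n) | u <- map gen a] /\ C a' = i (Delta * k').
  elim: n {def_D} => [|n [a' [k' [def_a' Ca']]]].
    by exists a, k; rewrite map_conjg1.
  have [a2 def_a2] := conj_Delta_gen a'; have [k2 def_k2] := Delta_swapl gM k'.
  exists a2, k2; split; first by rewrite def_a2 def_a' expgSr map_conjgM.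
  by rewrite /C def_a2 coxeter_conj -/(C a') Ca' conjgE -iM
    -[_ * _ * Delta]mulgA def_k2 [i (_ * (_ * _))]iM mulKg.
have [c Cc] := coxeter_gen_in b.
have iX z m : i (z ^+ m) = i z ^+ m.
  by elim: m => [|m IHm]; rewrite ?i1 // !expgS iM IHm.
apply: (@hc_equiv_trans _ _ (map gen a')); last first.
  by apply: hc_equiv_sym; rewrite def_a'; apply: hc_equiv_conj.
apply: (@hc_equiv_positive_conj c (Delta * k') (x * y') k') => //.
apply: i_inj; rewrite iM [RHS]iM Cc -Ca' /C def_a' coxeter_conj -/(C a) -/(C b).
have -> : i (x * y') = g^-1 * i Delta ^+ n.
  by rewrite -iX def_D def_g !iM mulgA mulgVK.
by rewrite Cb !conjgE !mulgA !mulgK.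
Qed.

End GeneratorSystems.

Theorem corollary3
  (G : groupType) (M : monoidType) (i : M -> G) (Delta : M)
  (garsideG : garside_group i Delta)
  (P : positive_presentation) (gen : letters P -> G)
  (presG : presents gen)
  (assocM : is_assoc_monoid gen i)
  (compatP : forall V W : seq (letters P),
     is_relation V W -> hurwitz_compatible gen V W)
  (gen_inj : injective gen)
  (gen_atoms : forall g : G,
     (exists s : letters P, gen s = g) <-> (exists2 x : M, atom x & i x = g))
  (a a' : seq (letters P)) :
  let ga := map gen a in
  let ga' := map gen a' in
  (hurwitz_equiv ga ga' <-> coxeter ga = coxeter ga') /\
  ((exists x : M, i x = (i Delta)^-1 * coxeter ga) ->
     (hc_equiv ga ga' <-> conjugate (coxeter ga) (coxeter ga'))).
Proof.
move=> ga ga'; split.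
  by split=> [/coxeter_hurwitz_equiv | /(coxeter_gen_inj assocM compatP)].
case=> k def_k; split=> [/coxeter_hc_equiv //|].
apply: (hc_equiv_conjugate garsideG assocM compatP gen_atoms (k := k)).
have [_ [[_ iM] _ _]] := garsideG.
by rewrite iM def_k mulVKg.
Qed.
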